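(* Let $X$ be a complex Banach space and let $\mathfrak A$ be a strictly semi-transitive subalgebra of $\mathcal L(X)$. If $\mathfrak A$ is transitive, then $\mathfrak A$ is dense in $\mathcal L(X)$ in the weak operator topology.
   Context: $\mathcal L(X)$ is the algebra of all bounded linear operators on $X$; a subalgebra need not be unital or closed. For $x\in X$, the orbit of $x$ is $\mathfrak A x=\{Ax\mid A\in\mathfrak A\}$. $\mathfrak A$ is transitive if $\mathfrak A x$ is dense in $X$ for every non-zero $x\in X$. $\mathfrak A$ is strictly semi-transitive if for all non-zero $x,y\in X$ there exists $A\in\mathfrak A$ such that $Ax=y$ or $Ay=x$. *)

(* Defs.v *)
From HB Require Import structures.
From mathcomp Require Import all_boot all_order all_algebra.
From mathcomp Require Import boolp classical_sets functions reals topology.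
From mathcomp Require Import normedtype.
From mathcomp.real_closed Require Export complex.

Set Implicit Arguments.
Unset Strict Implicit.
Unset Printing Implicit Defensive.

Import Order.TTheory GRing.Theory Num.Theory.
Import numFieldNormedType.Exports.

Local Open Scope classical_set_scope.
Local Open Scope ring_scope.

Section bounded_operators.
Context {K : numFieldType} {X Y : normedModType K}.

Definition bounded_linear : {pred X -> Y} :=
  mem [set f : X -> Y | linear f /\ bounded_near f (nbhs (0 : X))].

Record boundedOp := BoundedOp {
  bop_fun :> X -> Y ;
  bop_funP : bop_fun \in bounded_linear }.

HB.instance Definition _ := [isSub for bop_fun].
HB.instance Definition _ := [Choice of boundedOp by <:].

Lemma bounded_linearP (f : X -> Y) :
  f \in bounded_linear <-> linear f /\ continuous f.
Proof.
have e (lf : linear f) : bounded_near f (nbhs (0 : X)) <-> continuous f.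
  pose g := GRing.isLinear.Build K X Y *:%R f lf.
  pose h : {linear X -> Y} := HB.pack f g.
  exact: (linear_bounded_continuous h).
by rewrite inE/=; split=> -[lf]; rewrite e.
Qed.

Lemma bop_linear (f : boundedOp) : linear f.
Proof. by have /bounded_linearP[] := bop_funP f. Qed.

Lemma bop_continuous (f : boundedOp) : continuous f.
Proof. by have /bounded_linearP[] := bop_funP f. Qed.

HB.instance Definition _ (f : boundedOp) :=
  GRing.isLinear.Build K X Y *:%R f (bop_linear f).

Lemma bounded_linear_submod : submod_closed bounded_linear.
Proof.
split.
  by apply/bounded_linearP; split; [move=> a u v; rewrite scaler0 addr0|
                                    exact: cst_continuous].
move=> a f g /bounded_linearP[lf cf] /bounded_linearP[lg cg].
apply/bounded_linearP; split.
  move=> b u v; rewrite !fctE lf lg !scalerDr !scalerA [b * a]mulrC.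
  by rewrite addrACA.
by move=> x; apply: cvgD; [apply: cvgZr; exact: cf|exact: cg].
Qed.

HB.instance Definition _ := GRing.isSubmodClosed.Build K (X -> Y)
  bounded_linear bounded_linear_submod.
HB.instance Definition _ := [SubChoice_isSubLmodule of boundedOp by <:].

End bounded_operators.

Arguments boundedOp {K} X Y.
Notation "''L' ( X )" := (boundedOp X X) (at level 8, format "''L' ( X )").

Section operator_algebra.
Context {K : numFieldType} {X : normedModType K}.
Implicit Types A B C : 'L(X).

Lemma bounded_linear_id : (id : X -> X) \in bounded_linear.
Proof. by apply/bounded_linearP; split=> // x; exact: cvg_id. Qed.

Lemma bounded_linear_comp A B : (A \o B) \in bounded_linear.
Proof.
apply/bounded_linearP; split; first by move=> a u v /=; rewrite !linearP.
by move=> x; apply: continuous_comp; exact: bop_continuous.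
Qed.

Definition bop_id : 'L(X) := BoundedOp bounded_linear_id.
Definition bop_comp A B : 'L(X) := BoundedOp (bounded_linear_comp A B).

Lemma bop_compA : associative bop_comp.
Proof. by move=> A B C; exact/val_inj. Qed.
Lemma bop_comp1l : left_id bop_id bop_comp.
Proof. by move=> A; exact/val_inj. Qed.
Lemma bop_comp1r : right_id bop_id bop_comp.
Proof. by move=> A; exact/val_inj. Qed.
Lemma bop_compDl : left_distributive bop_comp +%R.
Proof. by move=> A B C; exact/val_inj. Qed.
Lemma bop_compDr : right_distributive bop_comp +%R.
Proof.
by move=> A B C; apply/val_inj/funext => x /=; rewrite [LHS]linearD.
Qed.

HB.instance Definition _ := GRing.Zmodule_isPzRing.Build 'L(X)
  bop_compA bop_comp1l bop_comp1r bop_compDl bop_compDr.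

Definition op_orbit (A : set 'L(X)) (x : X) : set X := [set T x | T in A].

Definition subalgebra (A : set 'L(X)) :=
  [/\ A 0,
      forall S T, A S -> A T -> A (S + T),
      forall a T, A T -> A (a *: T)
    & forall S T, A S -> A T -> A (S * T)].

Definition transitive_algebra (A : set 'L(X)) :=
  forall x : X, x != 0 -> dense (op_orbit A x).

Definition strictly_semitransitive (A : set 'L(X)) :=
  forall x y : X, x != 0 -> y != 0 ->
    exists2 T, A T & T x = y \/ T y = x.

End operator_algebra.

Section weak_operator_topology.
Context {K : numFieldType}.
Variable X : normedModType K.

Definition matrix_coef (T : 'L(X)) : {ptws X * boundedOp X K^o -> K^o} :=
  fun p => p.2 (T p.1).

(* The coarsest topology on 'L(X) for which T |-> phi (T x) is continuous,
   for all x in X and all bounded linear functionals phi on X. *)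
Definition wot : topologicalType := initial_topology matrix_coef.

End weak_operator_topology.

(* Main.v *)
(* Strict semi-transitivity writes X * X as the union over n of the sets of
   pairs (x, y) with T x = y or T y = x for some T in A of norm at most n. By
   Baire one of these sets is dense in some ball, so that, for every x in a
   nonempty open set, each z is approximated within |z| / 2 by T x with T in
   A and |T| <= K |z|. Transitivity moves any nonzero y into that open set,
   hence gives the same property to y, and successive approximation (as in
   the open mapping theorem) shows that the SOT-closure B of A satisfies B y
   = X for every nonzero y, with norm control. An operator D commuting with B
   then satisfies |D z| <= K |D x| |z| for a fixed nonzero x, so the
   commutant of B is a normed division algebra, that is, the scalars
   (Gelfand-Mazur). Jacobson's density theorem now applies to B.

   Gelfand-Mazur is obtained without complex analysis: if the resolvent of D
   were defined everywhere, its norm at x would attain a positive maximum,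
   and averaging over 2^k-th roots spreads the maximum over a disc of fixed
   radius, hence along a whole ray, although the resolvent vanishes at
   infinity. *)
From HB Require Import structures.
Require Import Defs.
From mathcomp Require Import all_boot all_order all_algebra.
From mathcomp Require Import boolp classical_sets functions reals topology.
From mathcomp Require Import normedtype derive.
From mathcomp Require Import ring lra.
Import numFieldNormedType.Exports.

Set Implicit Arguments.
Unset Strict Implicit.
Unset Printing Implicit Defensive.

Import Order.TTheory GRing.Theory Num.Theory.

Local Open Scope classical_set_scope.
Local Open Scope ring_scope.

(** * Real-valued norms and geometric convergence *)

Section real_norm.
Context {R : realType}.

(* The norm of a normed space over [R[i]] takes its values in [R[i]]; [nr] is
   the same norm with values in [R]. *)
Definition nr {V : normedZmodType R[i]} (x : V) : R := complex.Re `|x|.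

Section zmod.
Context {V : normedZmodType R[i]}.
Implicit Types x y z : V.

Lemma nrE x : ((nr x)%:C)%C = `|x|.
Proof. by rewrite /nr RRe_real ?normr_real. Qed.

Lemma nr_ge0 x : 0 <= nr x.
Proof. by rewrite -lecR nrE rmorph0 normr_ge0. Qed.

Lemma nr_eq0 x : nr x = 0 -> x = 0.
Proof. by move=> x0; apply/normr0_eq0; rewrite -nrE x0. Qed.

Lemma nr0 : nr (0 : V) = 0.
Proof. by rewrite /nr normr0. Qed.

Lemma nr_gt0 x : x != 0 -> 0 < nr x.
Proof.
move=> x0; rewrite lt_neqAle nr_ge0 andbT eq_sym; apply/eqP => /nr_eq0 /eqP.
exact/negP.
Qed.

Lemma nrN x : nr (- x) = nr x.
Proof. by rewrite /nr normrN. Qed.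

Lemma nrD x y : nr (x + y) <= nr x + nr y.
Proof. by rewrite -lecR rmorphD /= !nrE ler_normD. Qed.

Lemma nrB x y : nr (x - y) <= nr x + nr y.
Proof. by rewrite -(nrN y) nrD. Qed.

Lemma nr_distC x y : nr (x - y) = nr (y - x).
Proof. by rewrite -nrN opprB. Qed.

Lemma nr_triangle y x z : nr (x - z) <= nr (x - y) + nr (y - z).
Proof. by have := nrD (x - y) (y - z); rewrite addrA subrK. Qed.

Lemma nr_lt x (e : R) : (nr x < e) = (`|x| < (e%:C)%C).
Proof. by rewrite -nrE ltcR. Qed.

End zmod.

Lemma nrZ (V : normedModType R[i]) (a : R[i]) (x : V) :
  nr (a *: x) = nr a * nr x.
Proof. by apply: complexI; rewrite rmorphM /= !nrE normrZ. Qed.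

Lemma nrM (a b : R[i]) : nr (a * b) = nr a * nr b.
Proof. by apply: complexI; rewrite rmorphM /= !nrE normrM. Qed.

Lemma nr_real (a : R) : nr (a%:C)%C = `|a|.
Proof. by apply: complexI; rewrite nrE normc_def /= expr0n addr0 sqrtr_sqr. Qed.

Lemma ballnrP (V : normedModType R[i]) (x y : V) (e : R) :
  ball x (e%:C)%C y <-> nr (x - y) < e.
Proof. by rewrite -ball_normE /ball_ /= nr_lt. Qed.

Lemma half_pow_small (C e : R) : 0 <= C -> 0 < e ->
  exists N, forall n, (N <= n)%N -> C / 2 ^+ n < e.
Proof.
move=> C0 e0; exists (Num.bound (C / e)) => n Nn.
have h : C / e < n%:R.
  apply: lt_le_trans (archi_boundP _) _; first by rewrite divr_ge0 // ltW.
  by rewrite ler_nat.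
have h2 : (n%:R : R) < 2 ^+ n by rewrite -natrX ltr_nat ltn_expl.
rewrite ltr_pdivrMr ?exprn_gt0 // mulrC -ltr_pdivrMr //.
exact: lt_trans h h2.
Qed.

(** The bound is a difference so that it telescopes: [C / 2 ^+ m] equals
    [2 * C / 2 ^+ m - 2 * C / 2 ^+ m.+1]. *)
Lemma nr_geom_dist (V : normedModType R[i]) (u : nat -> V) (C : R) :
  (forall n, nr (u n - u n.+1) <= C / 2 ^+ n) ->
  forall n m, (n <= m)%N -> nr (u n - u m) <= 2 * C / 2 ^+ n - 2 * C / 2 ^+ m.
Proof.
move=> uC n m; elim: m => [|m IH].
  by rewrite leqn0 => /eqP ->; rewrite !subrr nr0.
rewrite leq_eqVlt => /orP[/eqP <-|]; first by rewrite !subrr nr0.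
rewrite ltnS => /IH h.
apply: le_trans (nr_triangle (u m) _ _) _.
apply: le_trans (lerD h (uC m)) _.
have -> : 2 ^+ m.+1 = 2 * 2 ^+ m :> R by rewrite exprS.
have p0 : (2 ^+ m : R) != 0 by rewrite expf_neq0 ?pnatr_eq0.
rewrite le_eqVlt; apply/orP; left; apply/eqP.
by field; rewrite p0 expf_neq0 ?pnatr_eq0.
Qed.

Lemma nr_geom_cvg (V : completeNormedModType R[i]) (u : nat -> V) (C : R) :
  (forall n, nr (u n - u n.+1) <= C / 2 ^+ n) ->
  exists l, forall n, nr (u n - l) <= 2 * C / 2 ^+ n.
Proof.
move=> uC.
have C0 : 0 <= C.
  by have := le_trans (nr_ge0 _) (uC 0%N); rewrite expr0 divr1.
have C20 : 0 <= 2 * C by rewrite mulr_ge0.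
have ud := nr_geom_dist uC.
have ud' n m : (n <= m)%N -> nr (u n - u m) <= 2 * C / 2 ^+ n.
  move=> /ud /le_trans; apply; rewrite gerBl divr_ge0 //.
  exact: exprn_ge0.
have : cvg (u @ \oo).
  apply: cauchy_cvg; apply: cauchy_exP => e e0.
  have eR : ((complex.Re e)%:C)%C = e by rewrite RRe_real // gtr0_real.
  have e0' : 0 < complex.Re e by rewrite -ltcR eR.
  have [N HN] := half_pow_small C20 e0'.
  exists (u N); exists N => // n /= Nn.
  by rewrite -eR; apply/ballnrP; apply: le_lt_trans (ud' _ _ Nn) (HN _ _).
move=> /cvg_ex[/= l ul]; exists l => n.
apply/ler_addgt0Pr => e e0.
have /cvgrPdist_lt/(_ (e%:C)%C) := ul; rewrite ltcR => /(_ e0)[N _ HN].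
have := HN (maxn n N) (leq_maxr _ _); rewrite -nr_lt => hl.
apply: le_trans (nr_triangle (u (maxn n N)) _ _) _.
apply: lerD; first exact/ud'/leq_maxl.
by rewrite nr_distC ltW.
Qed.

Lemma linear_nr_bound (V W : normedModType R[i]) (T : boundedOp V W) :
  exists2 m, 0 <= m & forall x, nr (T x) <= m * nr x.
Proof.
have /linear_bounded_continuous/linear_boundedP := @bop_continuous _ _ _ T.
case=> M [Mr HM].
have M0 : M < `|M| + 1 by rewrite (le_lt_trans (real_ler_norm Mr)) // ltrDl.
exists (nr M + 1); first by rewrite addr_ge0 ?nr_ge0.
by move=> x; rewrite -lecR rmorphM rmorphD /= !nrE; exact: HM.
Qed.

Lemma bounded_linear_nr (V W : normedModType R[i]) (f : V -> W) m :
  linear f -> (forall x, nr (f x) <= m * nr x) -> f \in bounded_linear.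
Proof.
move=> lf fm; rewrite inE /=; split => //.
pose g := GRing.isLinear.Build R[i] V W *:%R f lf.
pose h : {linear V -> W} := HB.pack f g.
apply: (proj1 (bounded_funP h)) => r.
exists ((Num.max 0 m)%:C%C * r) => x xr.
have r0 : 0 <= r by apply: le_trans xr.
apply: (@le_trans _ _ ((Num.max 0 m)%:C%C * `|x|)); last first.
  by apply: ler_wpM2l => //; rewrite lecR le_max lexx.
rewrite -!nrE -rmorphM lecR /=; apply: le_trans (fm x) _.
by apply: ler_wpM2r; rewrite ?nr_ge0 // le_max lexx orbT.
Qed.

End real_norm.

(** * Baire category *)

(** Otherwise one builds balls whose radii at least halve, the n-th step avoiding [P n], and the
    limit of the centres lies in no [P n]. Completeness is phrased for geometric steps, a form that
    passes from [X] to [X * X] coordinatewise. *)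
Lemma geom_complete_baire (R : realType) (T : Type) (d : T -> T -> R)
    (P : nat -> set T) (x0 : T) :
  (forall x, d x x = 0) ->
  (forall y x z, d x z <= d x y + d y z) ->
  (forall u C, (forall n, d (u n) (u n.+1) <= C / 2 ^+ n) ->
    exists l, forall n, d (u n) l <= 2 * C / 2 ^+ n) ->
  (forall x, exists n, P n x) ->
  exists n x, exists2 e, 0 < e &
    forall y, d x y < e -> forall t, 0 < t -> exists2 z, P n z & d y z < t.
Proof.
move=> dxx dtri dcpl Pcov; apply: contrapT => noP.
have step (p : nat * (T * R)) : exists q : T * R, 0 < p.2.2 ->
    [/\ 0 < q.2, q.2 <= p.2.2 / 2, d p.2.1 q.1 <= p.2.2 / 4 &
        forall z, P p.1 z -> q.2 <= d q.1 z].
  case: p => n [x e] /=; apply: contrapT => noq; apply: noP.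
  have e0 : 0 < e.
    by apply: contrapT => ne; apply: noq; exists (x, e) => /ne.
  have e40 : 0 < e / 4 by rewrite divr_gt0 // ltr0n.
  exists n, x, (e / 4) => // y xy t t0; apply: contrapT => noz; apply: noq.
  exists (y, Num.min t (e / 2)) => _ /=; split.
  - by rewrite lt_min t0 divr_gt0 // ltr0n.
  - by rewrite ge_min lexx orbT.
  - exact: ltW.
  - move=> z Pz; rewrite ge_min; apply/orP; left; rewrite leNgt; apply/negP.
    by move=> yz; apply: noz; exists z.
have [f fP] := choice step.
pose fix s n := if n is k.+1 then f (k, s k) else (x0, 1).
pose x n := (s n).1; pose e n := (s n).2.
have e0 n : 0 < e n.
  by elim: n => [|n IH]; [exact: ltr01|have [] := fP (n, s n) IH].
have sP n : [/\ e n.+1 <= e n / 2, d (x n) (x n.+1) <= e n / 4 &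
    forall z, P n z -> e n.+1 <= d (x n.+1) z].
  by have [] := fP (n, s n) (e0 n).
have e_pow n : e n <= 1 / 2 ^+ n.
  elim: n => [|n IH]; first by rewrite expr0 divr1.
  have [h _ _] := sP n; apply: le_trans h _.
  by rewrite exprSr invfM mulrA ler_pM2r // invr_gt0 ltr0n.
(* A step is at most [e n / 4], hence at most [e n / 2 - e n.+1 / 2], which telescopes; the limit
   stays within half the radius of every centre. *)
have xdist n m : (n <= m)%N -> d (x n) (x m) <= e n / 2 - e m / 2.
  elim: m => [|m IH]; first by rewrite leqn0 => /eqP ->; rewrite dxx subrr.
  rewrite leq_eqVlt => /orP[/eqP <-|]; first by rewrite dxx subrr.
  rewrite ltnS => /IH h; apply: le_trans (dtri (x m) _ _) _.
  by have [h1 h2 _] := sP m; lra.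
have [l lP] : exists l, forall n, d (x n) l <= 2 * (1 / 4) / 2 ^+ n.
  apply: dcpl => n; have [_ h _] := sP n; apply: le_trans h _.
  by rewrite [1 / 4 / _]mulrAC ler_pM2r ?e_pow // invr_gt0 ltr0n.
have xl n : d (x n) l <= e n / 2.
  apply/ler_addgt0Pr => t t0.
  have [|N HN] := @half_pow_small R (2 * (1 / 4)) t _ t0; first by lra.
  apply: le_trans (dtri (x (maxn n N)) _ _) _; apply: lerD.
    apply: le_trans (xdist _ _ (leq_maxl _ _)) _.
    by rewrite gerBl divr_ge0 // ltW.
  exact/ltW/(le_lt_trans (lP _))/HN/leq_maxr.
have [n Pn] := Pcov l.
have [_ _ /(_ l Pn)] := sP n.
by have := xl n.+1; have := e0 n.+1; lra.
Qed.

(** * From strict semi-transitivity to almost surjective orbit maps *)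

Section almost_surjective.
Context {R : realType} {X : completeNormedModType R[i]}.
Implicit Type A : set 'L(X).

Definition op_bounded_by (T : 'L(X)) (m : R) := forall x, nr (T x) <= m * nr x.

Let pdist (p q : X * X) : R := Num.max (nr (p.1 - q.1)) (nr (p.2 - q.2)).

Lemma sst_baire A : strictly_semitransitive A -> A 0 ->
  exists x0 y0 m e, [/\ 0 <= m, 0 < e & forall x y t,
    nr (x0 - x) < e -> nr (y0 - y) < e -> 0 < t ->
    exists x' y' T, [/\ A T, op_bounded_by T m, T x' = y',
                        nr (x - x') < t & nr (y - y') < t]].
Proof.
move=> sst A0.
(* The parity of [n] records which alternative holds, so one countable family covers both; [n]
   itself bounds the norm. *)
pose P (n : nat) : set (X * X) := [set p | exists T,
  [/\ A T, op_bounded_by T n%:R & if odd n then T p.2 = p.1 else T p.1 = p.2]].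
have [||||n [[x0 y0] [e e0 H]]] := @geom_complete_baire R _ pdist P (0, 0).
- by move=> p; rewrite /pdist !subrr !nr0 maxxx.
- move=> q p r; rewrite /pdist ge_max.
  apply/andP; split.
    apply: le_trans (nr_triangle q.1 _ _) _.
    by apply: lerD; rewrite le_max lexx.
  apply: le_trans (nr_triangle q.2 _ _) _.
  by apply: lerD; rewrite le_max lexx orbT.
- move=> u C uC.
  have [n|l1 l1P] := @nr_geom_cvg R X (fst \o u) C.
    by apply: le_trans (uC n); rewrite le_max lexx.
  have [n|l2 l2P] := @nr_geom_cvg R X (snd \o u) C.
    by apply: le_trans (uC n); rewrite le_max lexx orbT.
  by exists (l1, l2) => n; rewrite ge_max l1P l2P.
- move=> [x y].
  have bound T (b : bool) : A T -> (if b then T y = x else T x = y) ->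
      exists n, P n (x, y).
    move=> AT Txy; have [m m0 mT] := linear_nr_bound T.
    exists (b + (Num.bound m).*2)%N, T; split => //; last first.
      by rewrite oddD odd_double addbF; case: b Txy.
    move=> z; apply: le_trans (mT z) _; apply: ler_wpM2r; first exact: nr_ge0.
    apply: le_trans (ltW (archi_boundP m0)) _; rewrite ler_nat.
    by rewrite -addnn addnA leq_addl.
  (* Semi-transitivity is silent on zero vectors; the zero operator serves such pairs. *)
  have [y0|y0] := eqVneq y 0.
    by apply: (bound 0 false A0); rewrite y0.
  have [x0|x0] := eqVneq x 0.
    by apply: (bound 0 true A0); rewrite x0.
  have [T AT [Txy|Tyx]] := sst x y x0 y0; first exact: (bound T false).
  exact: (bound T true).
(* For odd [n] the coordinates are exchanged, so that the conclusion has a single direction. *)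
case nodd : (odd n).
- exists y0, x0, n%:R, e; split => // x y t xe ye t0.
  have [|[a b] [T [AT bT]]] := H (y, x) _ t t0.
    by rewrite /pdist /= gt_max xe ye.
  rewrite nodd /= => Tab; rewrite /pdist /= gt_max => /andP[ya xb].
  by exists b, a, T.
- exists x0, y0, n%:R, e; split => // x y t xe ye t0.
  have [|[a b] [T [AT bT]]] := H (x, y) _ t t0.
    by rewrite /pdist /= gt_max xe ye.
  rewrite nodd /= => Tab; rewrite /pdist /= gt_max => /andP[xa yb].
  by exists a, b, T.
Qed.

(** The input of successive approximation: the residual halves while the operator used has norm
    proportional to it, so the corrections sum geometrically. *)
Definition almost_onto A (x : X) (K : R) :=
  forall z, exists T, [/\ A T, op_bounded_by T (K * nr z) &
                          nr (T x - z) <= nr z / 2].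

(** Two operators of norm at most [m] send the same [x] close to [y0 + a *: z] and to [y0]; their
    difference divided by [a] sends [x] close to [z]. *)
Lemma sst_almost_onto A : subalgebra A -> strictly_semitransitive A ->
  exists x0 e K, [/\ 0 < e, 0 <= K &
    forall x, nr (x0 - x) < e -> almost_onto A x K].
Proof.
move=> [A0 AD AZ AM] sst.
have [x0 [y0 [m [e [m0 e0 H]]]]] := sst_baire sst A0.
(* Replacing [x'] by [x] costs at most [m * nr (x - x')], whence the tolerance [t / (m + 1)]. *)
have H2 x y t : nr (x0 - x) < e -> nr (y0 - y) < e -> 0 < t ->
    exists T, [/\ A T, op_bounded_by T m & nr (T x - y) < t].
  move=> xe ye t0.
  have t10 : 0 < t / (m + 1) by rewrite divr_gt0 // ltr_wpDl.
  have [x' [y' [T [AT bT Txy xx yy]]]] := H x y _ xe ye t10.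
  exists T; split => //.
  apply: le_lt_trans (nr_triangle y' _ _) _.
  have -> : t = m * (t / (m + 1)) + t / (m + 1).
    by rewrite -[X in _ + X]mul1r -mulrDl mulrC divfK // gt_eqF // ltr_wpDl.
  apply: ler_ltD; last by rewrite nr_distC.
  rewrite -Txy -linearB; apply: le_trans (bT _) _.
  by apply: ler_wpM2l => //; exact: ltW.
have K0 : 0 <= 4 * m / e by rewrite divr_ge0 ?mulr_ge0 // ltW.
exists x0, e, (4 * m / e); split => // x xe z.
have [->|z0] := eqVneq z 0.
  exists 0; split => //; last by rewrite subr0 /= !nr0 mul0r.
  by move=> w /=; rewrite !nr0 mulr0 mul0r.
have nz0 := nr_gt0 z0.
(* This puts [y0 + a *: z] at distance [e / 2] from [y0]. With [t = e / 8] the error [2 * t / a] is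
   [nr z / 2], and the norm bound [2 * m / a] is [4 * m / e * nr z]. *)
pose a := e / (2 * nr z).
have a0 : 0 < a by rewrite divr_gt0 // mulr_gt0.
pose t := e / 8.
have t0 : 0 < t by rewrite divr_gt0 // ltr0n.
have [|T1 [AT1 bT1 T1x]] := H2 x (y0 + (a%:C)%C *: z) t xe _ t0.
  rewrite opprD addrA subrr sub0r nrN nrZ nr_real gtr0_norm // /a.
  have -> : e / (2 * nr z) * nr z = e / 2 by field; rewrite ?gt_eqF.
  lra.
have [|T2 [AT2 bT2 T2x]] := H2 x y0 t xe _ t0; first by rewrite subrr nr0.
exists ((a^-1%:C)%C *: (T1 + (-1) *: T2)); split.
- by apply: (AZ); apply: (AD) => //; exact: AZ.
- move=> w /=; rewrite nrZ nr_real gtr0_norm ?invr_gt0 // scaleN1r.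
  apply: (@le_trans _ _ (a^-1 * (m * nr w + m * nr w))).
    rewrite ler_pM2l ?invr_gt0 //.
    by apply: le_trans (nrB _ _) (lerD (bT1 w) (bT2 w)).
  rewrite le_eqVlt; apply/orP; left; apply/eqP.
  by rewrite /a; field; rewrite ?gt_eqF.
- set S := T1 + _.
  have -> : ((a^-1%:C)%C *: S) x - z = (a^-1%:C)%C *: (S x - (a%:C)%C *: z).
    by rewrite scalerBr scalerA -rmorphM /= mulVf ?gt_eqF // scale1r.
  rewrite nrZ nr_real gtr0_norm ?invr_gt0 //.
  apply: (@le_trans _ _ (a^-1 * (t + t))).
    rewrite ler_pM2l ?invr_gt0 //.
    have -> : S x - (a%:C)%C *: z = (T1 x - (y0 + (a%:C)%C *: z)) - (T2 x - y0).
      have -> : S x = T1 x - T2 x by rewrite /S scaleN1r.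
      rewrite opprB opprD !addrA [LHS]addrAC; congr (_ - _).
      by rewrite [X in _ = X + _]addrAC subrK.
    by apply: le_trans (nrB _ _) (lerD _ _); exact: ltW.
  rewrite le_eqVlt; apply/orP; left; apply/eqP.
  by rewrite /a /t; field; rewrite ?gt_eqF.
Qed.

Lemma sst_transitive_almost_onto A : subalgebra A ->
  strictly_semitransitive A -> transitive_algebra A ->
  forall y, y != 0 -> exists2 K, 0 <= K & almost_onto A y K.
Proof.
move=> sA sst tA y y0; have [x0 [e [K [e0 K0 H]]]] := sst_almost_onto sA sst.
have [||y' [xe [T AT Ty]]] := tA y y0 (ball x0 (e%:C)%C).
- exists x0; apply: ballxx; by rewrite ltcR.
- by apply: ball_open; rewrite ltcR.
have /ballnrP := xe; rewrite -Ty => {}xe.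
have [m m0 mT] := linear_nr_bound T.
exists (K * m) => [|z]; first exact: mulr_ge0.
have [S [AS bS Sz]] := H _ xe z.
exists (S * T); split => //; first by case: sA => _ _ _; apply.
move=> w /=; apply: le_trans (bS _) _.
have -> : K * m * nr z * nr w = K * nr z * (m * nr w) by ring.
by apply: ler_wpM2l; rewrite ?mulr_ge0 ?nr_ge0.
Qed.

End almost_surjective.

(** * Strong operator closure and exact surjectivity *)

Section sot_closure.
Context {R : realType} {X : completeNormedModType R[i]}.
Implicit Type A : set 'L(X).

Definition sot_closure A : set 'L(X) := [set T | forall (s : seq X) e, 0 < e ->
  exists2 S, A S & forall x, x \in s -> nr (S x - T x) < e].

Lemma sub_sot_closure A : A `<=` sot_closure A.
Proof. by move=> T AT s e e0; exists T => // x _; rewrite subrr nr0. Qed.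

Lemma sot_closure_subalgebra A : subalgebra A -> subalgebra (sot_closure A).
Proof.
move=> [A0 AD AZ AM]; split; first exact: sub_sot_closure.
- move=> S T cS cT s e e0; have e20 : 0 < e / 2 by rewrite divr_gt0.
  have [S' AS' SS'] := cS s _ e20; have [T' AT' TT'] := cT s _ e20.
  exists (S' + T'); first exact: AD.
  move=> x xs; rewrite opprD addrACA.
  by apply: le_lt_trans (nrD _ _) _; rewrite [e]splitr ltrD ?SS' ?TT'.
- move=> a T cT s e e0; have a0 : 0 < nr a + 1 by rewrite ltr_wpDl ?nr_ge0.
  have [T' AT' TT'] := cT s _ (divr_gt0 e0 a0).
  exists (a *: T'); first exact: AZ.
  move=> x xs; rewrite -scalerBr nrZ.
  apply: (@le_lt_trans _ _ ((nr a + 1) * nr (T' x - T x))).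
    by apply: ler_wpM2r; rewrite ?nr_ge0 // lerDl.
  by rewrite mulrC -ltr_pdivlMr //; exact: TT'.
(* Multiplication need not be jointly SOT-continuous: [S'] is fixed first, on the vectors [T x], and
   the tolerance for [T'] depends on its norm. *)
- move=> S T cS cT s e e0; have e20 : 0 < e / 2 by rewrite divr_gt0.
  have [S' AS' SS'] := cS (map T s) _ e20.
  have [m m0 mS'] := linear_nr_bound S'.
  have m1 : 0 < m + 1 by rewrite ltr_wpDl.
  have [T' AT' TT'] := cT s _ (divr_gt0 e20 m1).
  exists (S' * T'); first exact: AM.
  move=> x xs; apply: le_lt_trans (nr_triangle (S' (T x)) _ _) _.
  rewrite [e]splitr; apply: ltrD; last exact/SS'/map_f.
  have -> : (S' * T') x - S' (T x) = S' (T' x - T x) by rewrite linearB.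
  apply: le_lt_trans (mS' _) _.
  apply: (@le_lt_trans _ _ ((m + 1) * nr (T' x - T x))).
    by apply: ler_wpM2r; rewrite ?nr_ge0 // lerDl.
  by rewrite mulrC -ltr_pdivlMr //; exact: TT'.
Qed.

(** The limit is taken pointwise; since [S 0] vanishes, the error estimate at [n = 0] is its norm
    bound. *)
Lemma bop_cvg (S : nat -> 'L(X)) (C : R) : 0 <= C -> S 0%N = 0 ->
  (forall n w, nr (S n w - S n.+1 w) <= C * nr w / 2 ^+ n) ->
  exists T : 'L(X), op_bounded_by T (2 * C) /\
    forall n w, nr (S n w - T w) <= 2 * (C * nr w) / 2 ^+ n.
Proof.
move=> C0 S0 SC.
have [f fP] := choice (fun w => nr_geom_cvg (SC ^~ w)).
have small w e : 0 < e -> exists n, nr (S n w - f w) < e.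
  move=> e0; have [|N HN] := @half_pow_small R (2 * (C * nr w)) e _ e0.
    by rewrite !mulr_ge0 ?nr_ge0.
  by exists N; apply: le_lt_trans (fP _ _) (HN _ _).
have fb w : nr (f w) <= 2 * C * nr w.
  by have := fP w 0%N; rewrite S0 sub0r nrN expr0 divr1 mulrA.
have lf : linear f.
  move=> a u v; apply/eqP; rewrite -subr_eq0; apply/eqP/nr_eq0/le_anti.
  rewrite nr_ge0 andbT.
  pose c := 2 * (C * nr (a *: u + v)) + nr a * (2 * (C * nr u))
            + 2 * (C * nr v).
  have c0 : 0 <= c by rewrite !addr_ge0 // !mulr_ge0 ?nr_ge0.
  apply/ler_addgt0Pr => e e0; rewrite add0r.
  have [N HN] := half_pow_small c0 e0.
  apply: le_trans (ltW (HN N (leqnn N))).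
  have -> : f (a *: u + v) - (a *: f u + f v) =
    a *: (S N u - f u) + (S N v - f v) - (S N (a *: u + v) - f (a *: u + v)).
    have E (p q r t w : X) : w - (q + t) = p - q + (r - t) - (p + r - w).
      rewrite [p - q + _]addrACA -(opprD q t) opprB [RHS]addrC [RHS]addrA.
      by rewrite subrK.
    by rewrite (linearP (S N)) scalerBr -E.
  apply: le_trans (nrB _ _) _; apply: le_trans (lerD (nrD _ _) (lexx _)) _.
  have h4 := ler_wpM2l (nr_ge0 a) (fP u N).
  have := fP (a *: u + v) N; have := fP v N.
  rewrite nrZ /c !mulrDl -[nr a * _ / _]mulrA; lra.
exists (BoundedOp (bounded_linear_nr lf fb)); split => // n w; exact: fP.
Qed.

(* The successive-approximation half of the open mapping theorem. *)
Lemma almost_onto_onto A y K : subalgebra A -> 0 <= K -> almost_onto A y K ->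
  forall z, exists T, [/\ sot_closure A T, op_bounded_by T (2 * (K * nr z)) &
                          T y = z].
Proof.
move=> [A0 AD AZ AM] K0 /choice[f fP] z.
(* [r n] is the residual after [n] corrections and [S n] their sum, with invariant
   [S n y = z - r n]. *)
pose r n := iter n (fun w => w - f w y) z.
pose S := fix S n := if n is k.+1 then S k + f (r k) else 0 : 'L(X).
have AS n : A (S n).
  by elim: n => [|n IH] //=; apply: AD => //; have [] := fP (r n).
have r_small n : nr (r n) <= nr z / 2 ^+ n.
  elim: n => [|n IH]; first by rewrite expr0 divr1.
  have [_ _ h] := fP (r n); rewrite /= nr_distC; apply: le_trans h _.
  by rewrite exprSr invfM mulrA ler_pM2r // invr_gt0.
have Sy n : S n y = z - r n.
  elim: n => [|n IH]; first by rewrite subrr.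
  rewrite -[LHS]/(S n y + f (r n) y) IH -[r n.+1]/(r n - f (r n) y).
  by rewrite opprB addrA [RHS]addrAC.
have [|//|n w|T [bT ST]] := @bop_cvg S (K * nr z).
- by rewrite mulr_ge0 ?nr_ge0.
- have [_ h _] := fP (r n).
  rewrite nr_distC -[S n.+1 w]/(S n w + f (r n) w) addrAC subrr add0r.
  apply: le_trans (h w) _; rewrite -!mulrA; apply: ler_wpM2l => //.
  by rewrite [nr w * _]mulrC mulrA; apply: ler_wpM2r; rewrite ?nr_ge0.
exists T; split => //.
- move=> s e e0.
  pose c := \sum_(x <- s) 2 * (K * nr z * nr x).
  have c0 x : 0 <= 2 * (K * nr z * nr x) by rewrite !mulr_ge0 ?nr_ge0.
  have [|N HN] := @half_pow_small R c e _ e0; first by rewrite sumr_ge0.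
  exists (S N) => // x xs; apply: le_lt_trans (HN N (leqnn N)).
  apply: le_trans (ST _ _) _.
  rewrite ler_pM2r ?invr_gt0 ?exprn_gt0 // /c (big_rem x) //= lerDl.
  exact: sumr_ge0.
- apply/eqP; rewrite -subr_eq0; apply/eqP/nr_eq0/le_anti.
  rewrite nr_ge0 andbT; apply/ler_addgt0Pr => e e0; rewrite add0r.
  pose c := nr z + 2 * (K * nr z * nr y).
  have [|N HN] := @half_pow_small R c e _ e0.
    by rewrite addr_ge0 ?mulr_ge0 ?nr_ge0 ?mulr_ge0 ?nr_ge0.
  apply: le_trans (ltW (HN N (leqnn N))).
  apply: le_trans (nr_triangle (S N y) _ _) _.
  rewrite /c mulrDl addrC; apply: lerD; last by rewrite nr_distC ST.
  by rewrite Sy addrC addKr nrN.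
Qed.

End sot_closure.

(* Jacobson's density theorem for a strictly transitive algebra whose
   commutant is reduced to the scalars. *)
Section jacobson_density.
Context {K : numFieldType} {X : normedModType K}.
Variable A : set 'L(X).
Hypothesis sA : subalgebra A.
Hypothesis onto_A : forall y, y != 0 -> forall z, exists2 T, A T & T y = z.
Hypothesis schur_A : forall D : X -> X, linear D ->
  (forall T, A T -> forall z, D (T z) = T (D z)) ->
  exists a, forall z, D z = a *: z.

(** Let [L] be the part of [A] killing the tail. If [L] kills [y], induct; otherwise [L y] is all of
    [X], and [T y] to [T x] is a well-defined map commuting with [A], hence a scalar [a]. Then [L]
    kills [x - a *: y], to which induction applies. *)
Lemma annihilator_density (s : seq X) (x : X) :
  (forall T, A T -> (forall y, y \in s -> T y = 0) -> T x = 0) ->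
  forall D : 'L(X), (forall y, y \in s -> D y = 0) -> D x = 0.
Proof.
have [A0 AD AZ AM] := sA.
elim: s x => [|y s IH] x Hx D Ds.
  have [->|x0] := eqVneq x 0; first by rewrite linear0.
  have [T AT Tx] := onto_A x0 x.
  by move: (Hx T AT); rewrite Tx => -> //; rewrite linear0.
have Dy : D y = 0 by apply: Ds; rewrite mem_head.
have Ds' w : w \in s -> D w = 0 by move=> ws; apply: Ds; rewrite inE ws orbT.
pose L := [set T | A T /\ forall w, w \in s -> T w = 0].
have [Ly|] := pselect (forall T, L T -> T y = 0).
  apply: IH => // T AT Ts; apply: Hx => // w; rewrite inE => /orP[/eqP ->|].
    by apply: Ly.
  exact: Ts.
move=> /existsNP[T0 /not_implyP[[AT0 T0s] /eqP T0y]].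
have LX z : exists T, L T /\ T y = z.
  have [S AS ST] := onto_A T0y z.
  exists (S * T0); split => //; split; first exact: AM.
  by move=> w ws /=; rewrite T0s // linear0.
have [g gP] := choice LX.
(* Well-definedness: the difference of the two operators kills [y] and the tail, hence [x]. *)
have gE T : L T -> g (T y) x = T x.
  move=> [AT Ts]; have [[Ag gs] gy] := gP (T y).
  apply/eqP; rewrite -subr_eq0.
  have AS : A (g (T y) + (-1) *: T) by apply: (AD) => //; exact: AZ.
  have := Hx _ AS; rewrite scaleN1r => h; apply/eqP; apply: h => w.
  rewrite inE => /orP[/eqP ->|ws].
    by rewrite -[LHS]/(g (T y) y - T y) gy subrr.
  rewrite -[LHS]/(g (T y) w - T w).
  by rewrite gs // Ts // subrr.
have gD a u v : g (a *: u + v) x = a *: g u x + g v x.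
  have [[Au us] uy] := gP u; have [[Av vs] vy] := gP v.
  rewrite -[in LHS]uy -[in LHS]vy -[LHS]/(g ((a *: g u + g v) y) x) gE //.
  split; first by apply: AD => //; exact: AZ.
  move=> w ws; rewrite -[LHS]/(a *: g u w + g v w).
  by rewrite us // vs // scaler0 addr0.
have [T AT z|a ga] := schur_A (D := fun z => g z x) gD.
  have [[Az zs] zy] := gP z.
  rewrite -[in LHS]zy -[LHS]/(g ((T * g z) y) x) gE //.
  split; first exact: AM.
  by move=> w ws /=; rewrite zs // linear0.
have : D (x - a *: y) = 0.
  apply: IH => // T AT Ts.
  by rewrite linearB linearZ /= -ga gE // subrr.
by rewrite linearB linearZ /= Dy scaler0 subr0.
Qed.

(** Interpolation one vector at a time: some [Q] killing [s] but not [x] lets [P * Q] correct [S] at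
    [x]; if there is none, [S - T] vanishes at [x] already. *)
Lemma jacobson_density (T : 'L(X)) (s : seq X) :
  exists2 S, A S & forall x, x \in s -> S x = T x.
Proof.
have [A0 AD AZ AM] := sA.
elim: s => [|x s [S AS ST]]; first by exists 0.
have [H|] := pselect (forall Q, A Q ->
    (forall y, y \in s -> Q y = 0) -> Q x = 0).
  exists S => // y; rewrite inE => /orP[/eqP ->|]; last exact: ST.
  apply/eqP; rewrite -subr_eq0; apply/eqP.
  apply: (annihilator_density H (D := S - T)) => z zs.
  by rewrite -[LHS]/(S z - T z) ST // subrr.
move=> /existsNP[Q /not_implyP[AQ /not_implyP[Qs /eqP Qx]]].
have [P AP PQ] := onto_A Qx (T x - S x).
exists (S + P * Q); first by apply: AD => //; exact: AM.
move=> y; rewrite inE => /orP[/eqP ->|ys].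
  by rewrite -[LHS]/(S x + P (Q x)) PQ addrC subrK.
by rewrite -[LHS]/(S y + P (Q y)) Qs // linear0 addr0 ST.
Qed.

End jacobson_density.

(** * Gelfand-Mazur by averaging over roots *)

Section gelfand_mazur.
Context {R : realType}.

Lemma nr_complex (a b : R) : nr (a +i* b)%C = Num.sqrt (a ^+ 2 + b ^+ 2).
Proof. by apply: complexI; rewrite nrE normc_def. Qed.

Lemma nr_complex_le (a b : R) : nr (a +i* b)%C <= `|a| + `|b|.
Proof.
rewrite nr_complex -(@ler_pXn2r _ 2) ?nnegrE ?sqrtr_ge0 ?addr_ge0 //.
rewrite sqr_sqrtr ?addr_ge0 ?sqr_ge0 // sqrrD !real_normK ?num_real //.
by rewrite addrAC lerDl mulrn_wge0 ?mulr_ge0.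
Qed.

(** Beyond radius [K] the value is at most [g 0], so the maximum over a compact square containing
    that disc and 0 is global. *)
Lemma complex_attains_max (g : R[i] -> R) :
  (forall z e, 0 < e -> exists2 d, 0 < d &
    forall w, nr (z - w) < d -> `|g z - g w| < e) ->
  (forall e, 0 < e -> exists K, forall z, K < nr z -> g z <= e) ->
  0 < g 0 ->
  exists z, forall w, g w <= g z.
Proof.
move=> gc gd g0; have [K HK] := gd _ g0.
pose r := Num.max K 0.
have r0 : 0 <= r by rewrite le_max lexx orbT.
pose f (p : R * R) := g (p.1 +i* p.2)%C.
pose A : set (R * R) := `[- r, r] `*` `[- r, r].
have A00 : A (0, 0).
  by split; rewrite /= in_itv /= oppr_le0 r0.
have [|||p Ap pmax] := @compact_EVT_max _ R f A.
- by exists (0, 0).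
- by apply: compact_setX; exact: segment_compact.
- apply: continuous_subspaceT => x; apply/cvgrPdist_lt => e e0.
  have [d d0 Hd] := gc (x.1 +i* x.2)%C _ e0.
  have d20 : 0 < d / 2 by rewrite divr_gt0.
  apply: filterS (nbhsx_ballx x (d / 2) d20) => y [/= y1 y2]; apply: Hd.
  apply: le_lt_trans (nr_complex_le (x.1 - y.1) (x.2 - y.2)) _.
  by rewrite [d]splitr; apply: ltrD.
exists (p.1 +i* p.2)%C => -[a b].
have [Kn|nK] := ltP K (nr (a +i* b)%C).
  by apply: le_trans (HK _ Kn) _; exact: (pmax (0, 0) (mem_set A00)).
have nr' : nr (a +i* b)%C <= r by rewrite le_max nK.
have sqr_le c : c ^+ 2 <= a ^+ 2 + b ^+ 2 -> `|c| <= r.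
  move=> h; apply: le_trans nr'; rewrite nr_complex -sqrtr_sqr.
  exact: ler_wsqrtr.
apply: (pmax (a, b)); apply/mem_set; split;
  rewrite /= in_itv /= -ler_norml; apply: sqr_le.
  by rewrite lerDl sqr_ge0.
by rewrite lerDr sqr_ge0.
Qed.

Context {X : normedModType R[i]}.

(* [v s] stands for [(1 - s c)^-1 u]; averaging it over the [2 ^ k]-th roots of
   [s] gives [F s], which stands for [(1 - s c ^ (2 ^ k))^-1 u]. *)
Lemma root_average (c : X -> X) (u : X) (v : R[i] -> X) (M : R) (k : nat) :
  linear c -> (forall s, v s = u + s *: c (v s)) -> (forall s, nr (v s) <= M) ->
  exists F : R[i] -> X,
    [/\ forall s, F s = u + s *: iter (2 ^ k) c (F s),
        forall s, nr (F s) <= M &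
        forall t, M - nr (v t) <= 2 ^+ k * (M - nr (F (t ^+ (2 ^ k))))].
Proof.
move=> lc vE vM; elim: k => [|k [F [FE FM vF]]].
  by exists v; split => // t; rewrite expr0 mul1r.
pose ck := iter (2 ^ k) c.
have lck : linear ck.
  rewrite /ck; elim: (2 ^ k)%N => // n IH a y z; rewrite !iterS IH; exact: lc.
(* The choice of square root is immaterial, the average being even in the root. *)
pose G s := 2^-1 *: (F (sqrtc s) + F (- sqrtc s)).
have GE s : G (s ^+ 2) = 2^-1 *: (F s + F (- s)).
  rewrite /G; have : sqrtc (s ^+ 2) == s \/ sqrtc (s ^+ 2) == - s.
    by apply/orP; rewrite -eqf_sqr sqr_sqrtc.
  by case=> /eqP ->; rewrite ?opprK // addrC.
(* One root is kept and the other bounded by [M]: each averaging costs a factor 2 in the deficit. *)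
have G2 s : nr (G (s ^+ 2)) <= (nr (F s) + M) / 2.
  have n2 : nr (2^-1 : R[i]) = 2^-1.
    rewrite -(rmorph_nat (real_complex R)) -fmorphV nr_real.
    by rewrite ger0_norm // invr_ge0.
  rewrite GE nrZ n2 mulrC ler_pM2r ?invr_gt0 //.
  by apply: le_trans (nrD _ _) _; rewrite lerD2l.
have GM s : nr (G s) <= M.
  by have := G2 (sqrtc s); have := FM (sqrtc s); rewrite sqr_sqrtc; lra.
exists G; split => //.
- move=> s; rewrite -[s]sqr_sqrtc; set t := sqrtc s.
  rewrite expnS mul2n -addnn iterD -/ck GE.
  have lckZ a y : ck (a *: y) = a *: ck y.
    have ck0 : ck 0 = 0.
      by have := lck (-1) 0 0; rewrite scaler0 addr0 scaleN1r addNr.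
    by have := lck a y 0; rewrite !addr0 ck0 addr0.
  have lckD y z : ck (y + z) = ck y + ck z.
    by have := lck 1 y z; rewrite !scale1r.
  have E1 := FE t; have E2 := FE (- t); rewrite -/ck in E1 E2.
  (* Substituting the difference equation into the sum equation produces [t ^+ 2] and two copies of
     [ck]. *)
  have Esum : F t + F (- t) = 2 *: u + t *: ck (F t - F (- t)).
    rewrite -[F (- t) in RHS]scale1r -scaleNr lckD lckZ scaleN1r scalerBr.
    by rewrite {1}E1 {1}E2 scaleNr addrACA scaler_nat mulr2n.
  have Ediff : F t - F (- t) = t *: ck (F t + F (- t)).
    rewrite lckD scalerDr {1}E1 {1}E2 scaleNr opprD opprK addrACA subrr add0r.
    by [].
  rewrite {1}Esum Ediff !lckZ scalerDr !scalerA mulVf ?pnatr_eq0 // scale1r.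
  by congr (_ + _); rewrite expr2; congr (_ *: _); ring.
- move=> t; apply: le_trans (vF t) _.
  have := G2 (t ^+ (2 ^ k)); rewrite -exprM -expnSr => h.
  rewrite exprSr -mulrA; apply: ler_wpM2l; first by rewrite exprn_ge0.
  lra.
Qed.

(* The average of [v] over the [2 ^ k]-th roots of [t ^ (2 ^ k)] differs from
   [u] by at most [(nr t * L) ^ (2 ^ k) * nr u]; were [v t] shorter than [u],
   this average would be shorter by a fixed multiple of [2 ^ - k]. *)
Lemma max_propagates (c : X -> X) (u : X) (v : R[i] -> X) (L : R) (t : R[i]) :
  linear c -> (forall s, v s = u + s *: c (v s)) ->
  (forall s, nr (v s) <= nr u) -> (forall z, nr (c z) <= L * nr z) -> 0 <= L ->
  nr t * L <= 4^-1 -> nr (v t) = nr u.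
Proof.
move=> lc vE vM cL L0 tL; apply/le_anti; rewrite vM /=.
apply/ler_addgt0Pr => e e0; set M := nr u in vM *.
have [N HN] := half_pow_small (nr_ge0 u) e0.
have [F [FE FM vF]] := root_average N lc vE vM.
set n := (2 ^ N)%N in FE FM vF.
have cnL z : nr (iter n c z) <= L ^+ n * nr z.
  elim: (n) => [|i IH]; first by rewrite mul1r.
  by rewrite iterS exprS -mulrA; apply: le_trans (cL _) (ler_wpM2l L0 IH).
have nrX i : nr (t ^+ i) = nr t ^+ i.
  elim: i => [|i IH]; last by rewrite !exprS nrM IH.
  by rewrite !expr0 -[1]/((1%:C)%C) nr_real normr1.
have FuM : M - nr (F (t ^+ n)) <= 4^-1 ^+ n * M.
  have : M <= nr (F (t ^+ n)) + nr (t ^+ n *: iter n c (F (t ^+ n))).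
    have -> : M = nr (F (t ^+ n) - t ^+ n *: iter n c (F (t ^+ n))).
      by rewrite {1}FE addrK.
    exact: nrB.
  rewrite nrZ nrX -lerBlDl => h; apply: le_trans h _.
  apply: (@le_trans _ _ (nr t ^+ n * (L ^+ n * M))).
    apply: ler_wpM2l; first by rewrite exprn_ge0 ?nr_ge0.
    apply: le_trans (cnL _) _; apply: ler_wpM2l (FM _); exact: exprn_ge0.
  rewrite mulrA -exprMn; apply: ler_wpM2r; first exact: nr_ge0.
  by apply: lerXn2r tL; rewrite nnegrE ?mulr_ge0 ?nr_ge0 ?invr_ge0.
(* With [n = 2 ^ N], the decay [4^-1 ^+ n] far outweighs the factor [2 ^+ N] lost in averaging;
   [N <= n] suffices. *)
have small : 2 ^+ N * 4^-1 ^+ n <= (2 ^+ N)^-1 :> R.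
  have -> : 4^-1 = 2^-1 ^+ 2 :> R by rewrite expr2 -invfM -natrM.
  rewrite -exprM -exprVn.
  apply: (@le_trans _ _ (2 ^+ N * 2^-1 ^+ (2 * N))).
    apply: ler_wpM2l; first by rewrite exprn_ge0.
    apply: ler_wiXn2l; rewrite ?invr_ge0 ?invf_le1 ?ler1n //.
    by rewrite leq_mul2l /= /n ltnW // ltn_expl.
  by rewrite mul2n -addnn exprD mulrA -exprMn divff ?pnatr_eq0 // expr1n mul1r.
have h1 := vF t.
have h2 : 2 ^+ N * (M - nr (F (t ^+ n))) <= M / 2 ^+ N.
  apply: le_trans (ler_wpM2l _ FuM) _; first by rewrite exprn_ge0.
  by rewrite mulrA mulrC; apply: ler_wpM2l => //; exact: nr_ge0.
by have := HN N (leqnn N); lra.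
Qed.

(* [r l] is the resolvent [(T - l)^-1], and [m * nr (r l x)] a bound on its
   operator norm, so that maximizing [nr (r l x)] controls every resolvent. *)
Lemma resolvent_not_total (T : X -> X) (r : R[i] -> X -> X) (x : X) (m K : R) :
  x != 0 -> 0 <= m -> (forall z, nr (T z) <= K * nr z) ->
  (forall l, linear (r l)) ->
  (forall l z, r l (T z - l *: z) = z) ->
  (forall l z, T (r l z) - l *: r l z = z) ->
  (forall l z, nr (r l z) <= m * nr (r l x) * nr z) -> False.
Proof.
move=> x0 m0 TK lr rT Tr rm; pose g l := nr (r l x).
have rl0 l : r l 0 = 0.
  by have := lr l (-1) 0 0; rewrite scaler0 addr0 scaleN1r addNr.
have rD l y z : r l (y + z) = r l y + r l z.
  by have := lr l 1 y z; rewrite !scale1r.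
have rZ l a y : r l (a *: y) = a *: r l y.
  by have := lr l a y 0; rewrite !addr0 rl0 addr0.
(* The resolvent identity at [x], which is the equation required by [max_propagates] with
   [c := r l]. *)
have rE l s : r (l + s) x = r l x + s *: r l (r (l + s) x).
  set y := r (l + s) x.
  have : T y - l *: y = x + s *: y.
    have := Tr (l + s) x; rewrite -/y scalerDl opprD addrA => <-.
    by rewrite subrK.
  by move=> /(congr1 (r l)); rewrite rT rD rZ.
have g_gt0 l : 0 < g l.
  apply: nr_gt0; apply/eqP => rx0.
  have := Tr l x; rewrite rx0 scaler0 subr0 => Tx.
  have T0 : T 0 = 0.
    apply/nr_eq0/le_anti; rewrite nr_ge0 andbT.
    by have := TK 0; rewrite nr0 mulr0.
  by move: x0; rewrite -Tx T0 eqxx.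
have g_diff l w : nr (r l x - r w x) <= nr (l - w) * (m * g l * g w).
  have := rE l (w - l); rewrite addrC subrK => {1}->.
  rewrite opprD addrA subrr sub0r nrN nrZ nr_distC.
  by apply: ler_wpM2l (rm _ _); exact: nr_ge0.
have g_dist l w : `|g l - g w| <= nr (r l x - r w x).
  have h1 := nrD (r l x - r w x) (r w x).
  have h2 := nrD (r w x - r l x) (r l x).
  rewrite subrK in h1; rewrite subrK [nr (_ - _)]nr_distC in h2.
  by rewrite ler_norml /g; apply/andP; split; lra.
have g_cont l e : 0 < e -> exists2 d, 0 < d &
    forall w, nr (l - w) < d -> `|g l - g w| < e.
  move=> e0; have gl0 := g_gt0 l.
  have B0 : 0 <= m * g l by rewrite mulr_ge0 // ltW.
  have B1 : 0 < m * g l + 1 by rewrite ltr_wpDl.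
  (* The bound 1/2 absorbs [q * g w] and gives [g w <= 2 * g l]; the other bound then makes
     [q * (2 * g l)] less than [e]. *)
  exists (Num.min (1 / 2) (e / (2 * g l)) / (m * g l + 1)).
    by rewrite divr_gt0 // lt_min !divr_gt0 // mulr_gt0.
  move=> w; rewrite ltr_pdivlMr // lt_min => /andP[].
  set q := nr (l - w) * _ => q1 q2.
  have h : nr (r l x - r w x) <= q * g w.
    apply: le_trans (g_diff l w) _; rewrite !mulrA.
    apply: ler_wpM2r; first exact: nr_ge0.
    by rewrite -!mulrA; apply: ler_wpM2l; rewrite ?nr_ge0 // lerDl.
  have gw0 := g_gt0 w.
  have gw : g w <= 2 * g l.
    have : g w <= g l + q * g w.
      by have := le_trans (g_dist l w) h; rewrite ler_norml => /andP[]; lra.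
    have : q * g w <= 1 / 2 * g w by rewrite ler_pM2r // ltW.
    lra.
  apply: le_lt_trans (le_trans (g_dist l w) h) _.
  apply: (@le_lt_trans _ _ (q * (2 * g l))).
    by apply: ler_wpM2l => //; rewrite mulr_ge0 ?nr_ge0 // ltW.
  by rewrite -ltr_pdivlMr // mulr_gt0.
have g_decay e : 0 < e -> exists K', forall l, K' < nr l -> g l <= e.
  (* From [l *: r l x = T (r l x) - x] one gets [(nr l - K) * g l <= nr x]. *)
  move=> e0; exists (K + nr x / e) => l lK; rewrite leNgt; apply/negP => ge.
  have h : nr l * g l <= K * g l + nr x.
    rewrite -nrZ; have -> : l *: r l x = T (r l x) - x.
      by rewrite -[X in _ - X](Tr l x) opprB addrC subrK.
    by apply: le_trans (nrB _ _) _; rewrite lerD2r.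
  have h2 : (K + nr x / e) * g l < nr l * g l by rewrite ltr_pM2r.
  have h3 : nr x <= nr x / e * g l.
    by rewrite mulrAC ler_pdivlMr //; apply: ler_wpM2l (ltW ge); exact: nr_ge0.
  lra.
have [l0 l0max] := complex_attains_max g_cont g_decay (g_gt0 0).
have L0 : 0 <= m * g l0 by rewrite mulr_ge0 // ltW.
(* The step depends only on the maximal value [g l0], so the same [t] serves at every point reached
   along the ray. *)
pose t : R := (4 * (m * g l0 + 1))^-1.
have t0 : 0 < t by rewrite invr_gt0 mulr_gt0 // ltr_wpDl.
have gmax n : g (l0 + (n%:R * t)%:C%C) = g l0.
  elim: n => [|n IH]; first by rewrite mul0r addr0.
  rewrite -IH /g -addn1 natrD mulrDl mul1r rmorphD addrA.
  set l := l0 + _; rewrite -/l in IH.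
  apply: (@max_propagates (r l) _ (fun s => r (l + s) x) (m * g l0)) => //.
  - by move=> s; rewrite -[X in _ <= X]/(g l) IH; exact: l0max.
  - by move=> z; rewrite -IH.
  - rewrite nr_real gtr0_norm // /t invfM -mulrA ger_pMr ?invr_gt0 //.
    by rewrite mulrC ler_pdivrMr ?mul1r ?lerDl // ltr_wpDl.
have [K' HK'] : exists K', forall l, K' < nr l -> g l <= g l0 / 2.
  by apply: g_decay; rewrite divr_gt0.
pose n := Num.bound ((`|K'| + nr l0) / t).
have : K' < nr (l0 + (n%:R * t)%:C%C).
  have h : (`|K'| + nr l0) < n%:R * t.
    rewrite -ltr_pdivrMr // archi_boundP // divr_ge0 ?addr_ge0 ?nr_ge0 //.
    exact: ltW.
  have := nrB (l0 + (n%:R * t)%:C%C) l0; rewrite addrAC subrr add0r nr_real.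
  rewrite ger0_norm; last by rewrite mulr_ge0 // ltW.
  by have := ler_norm K'; lra.
move=> /HK'; rewrite gmax; have := g_gt0 l0; lra.
Qed.

End gelfand_mazur.

(** * Triviality of the commutant *)

Section commutant.
Context {R : realType} {X : completeNormedModType R[i]}.
Variable A : set 'L(X).

(** If [D] is not scalar, each [D - a] is injective, since a kernel vector is moved everywhere by
    [A], and surjective, since it maps [T x] to [T] of a fixed nonzero vector. The inverses commute
    with [A], so [comm_bound] controls them as [resolvent_not_total] forbids. *)
Lemma commutant_scalar (x : X) (K : R) :
  (forall y, y != 0 -> forall z, exists2 T, A T & T y = z) ->
  x != 0 -> 0 <= K ->
  (forall z, exists T, [/\ A T, op_bounded_by T (K * nr z) & T x = z]) ->
  forall D : X -> X, linear D ->
  (forall T, A T -> forall z, D (T z) = T (D z)) ->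
  exists a, forall z, D z = a *: z.
Proof.
move=> onto x0 K0 ontox.
pose comm (E : X -> X) := linear E /\
  forall T, A T -> forall z, E (T z) = T (E z).
have comm_bound E : comm E -> forall z, nr (E z) <= K * nr (E x) * nr z.
  move=> [_ cE] z; have [T [AT bT Tz]] := ontox z.
  rewrite -{1}Tz cE //; apply: le_trans (bT _) _; by rewrite mulrAC.
move=> D lD cD; apply: contrapT => noa.
have cDa a : comm (fun z => D z - a *: z).
  split=> [b u v|T AT z]; last by rewrite cD // (linearB T) (linearZ_LR T).
  by rewrite lD scalerDr scalerBr !scalerA [a * b]mulrC opprD addrACA.
have inj a y : D y - a *: y = 0 -> y = 0.
  move=> Ey; apply/eqP/negP => /negP y0; apply: noa; exists a => z.
  have [T AT <-] := onto y y0 z; apply/eqP; rewrite -subr_eq0; apply/eqP.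
  by have [_ ->] := cDa a; rewrite // Ey linear0.
have surj a z : exists w, D w - a *: w = z.
  have Ex0 : D x - a *: x != 0 by apply: contra_neq x0 => /inj.
  have [T AT Tz] := onto _ Ex0 z.
  by exists (T x); have [_ ->] := cDa a.
have [r rP] := choice (fun p : R[i] * X => surj p.1 p.2).
have rE a z : D (r (a, z)) - a *: r (a, z) = z := rP (a, z).
have uniq a y z : D y - a *: y = D z - a *: z -> y = z.
  move=> /eqP; rewrite -subr_eq0 => /eqP Eyz.
  apply/eqP; rewrite -subr_eq0; apply/eqP/(inj a); rewrite -Eyz.
  have -> : D (y - z) = D y - D z.
    by rewrite addrC -scaleN1r lD scaleN1r addrC.
  by rewrite scalerBr !opprD !opprK [LHS]addrACA.
have comm_r a : comm (fun z => r (a, z)).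
  have [lE cE] := cDa a; split=> [b u v|T AT z]; apply: (uniq a).
    by rewrite [RHS]lE /= !rE.
  by rewrite [RHS]cE //= !rE.
apply: (@resolvent_not_total R X D (fun a z => r (a, z)) x K
  (K * nr (D x))) => //.
- by apply: comm_bound.
- by move=> a; have [] := comm_r a.
- by move=> a z; apply: (uniq a); rewrite rE.
- by move=> a z; apply: (comm_bound _ (comm_r a)).
Qed.

End commutant.

(** * From strong to weak operator density *)

Section sot_wot.
Context {R : realType} {X : completeNormedModType R[i]}.

Lemma ptws_cvgP (U : Type) (V : topologicalType) (F : set_system (U -> V))
    (f : U -> V) : Filter F ->
  (forall t, (fun g : U -> V => g t) @ F --> f t) -> {ptws, F --> f}.
Proof.
move=> FF Ff; apply/cvg_sup => t; apply/cvg_image.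
  by rewrite eqEsubset; split=> v // _; exists (cst v).
move=> W /Ff Q; exists ((fun g : U -> V => g t) @^-1` W) => //.
by rewrite eqEsubset; split=> [_ [g Wg <-//]|w Ww]; exists (cst w).
Qed.

(** The trace on [A] of the SOT-neighbourhoods of [T] is a proper filter; each functional [phi] is
    bounded, so it converges to [T] weakly. *)
Lemma sot_dense_wot_dense (A : set 'L(X)) :
  (forall T, sot_closure A T) -> dense (A : set (wot X)).
Proof.
move=> sotA O [T OT] [W oW WO].
pose F : set_system 'L(X) := filter_from [set p : seq X * R | 0 < p.2]
  (fun p => [set S | A S /\ forall x, x \in p.1 -> nr (S x - T x) < p.2]).
have FF : ProperFilter F.
  apply: filter_from_proper => [|[s e] /= e0]; last first.
    by have [S AS Ss] := sotA T s e e0; exists S.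
  apply: filter_from_filter => [|[s e] [s' e'] /= e0 e0'].
    by exists ([::], 1) => /=.
  exists (s ++ s', Num.min e e') => /= [|S [AS HS]]; first by rewrite lt_min e0.
  split; split=> // x xs; have := HS x; rewrite mem_cat xs ?orbT lt_min;
    by move=> /(_ isT) /andP[].
have FT : {ptws, @matrix_coef _ X @ F --> @matrix_coef _ X T}.
  apply: ptws_cvgP => -[x phi].
  apply/cvgrPdist_lt => e e0 /=.
  have eR : ((complex.Re e)%:C)%C = e by rewrite RRe_real // gtr0_real.
  have e0' : 0 < complex.Re e by rewrite -ltcR eR.
  have [m m0 mphi] := linear_nr_bound phi.
  have m1 : 0 < m + 1 by rewrite ltr_wpDl.
  exists ([:: x], complex.Re e / (m + 1)); first by rewrite /= divr_gt0.
  move=> S [_ /(_ x (mem_head _ _))]; rewrite ltr_pdivlMr // => Sx /=.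
  rewrite -eR -nr_lt /matrix_coef /= -linearB.
  apply: le_lt_trans (mphi _) _; rewrite nr_distC mulrC.
  apply: le_lt_trans Sx; apply: ler_wpM2l; first exact: nr_ge0.
  by rewrite lerDl.
have FW : F O.
  rewrite -WO; apply: FT; apply: open_nbhs_nbhs; split => //.
  by move: OT; rewrite -WO.
have FA : F A by exists ([::], 1) => //= S [].
exact: filter_ex (filterI FW FA).
Qed.

End sot_wot.

Theorem theorem3p7 (R : realType) (X : completeNormedModType R[i])
  (A : set 'L(X)) :
  subalgebra A -> strictly_semitransitive A -> transitive_algebra A ->
  dense (A : set (wot X)).
Proof.
move=> sA sst tA; apply: sot_dense_wot_dense => T s e e0.
have onto y : y != 0 -> exists2 K, 0 <= K & forall z,
    exists S, [/\ sot_closure A S, op_bounded_by S (K * nr z) & S y = z].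
  move=> y0; have [K K0 HK] := sst_transitive_almost_onto sA sst tA y0.
  exists (2 * K); first by rewrite mulr_ge0.
  by move=> z; rewrite -mulrA; exact: almost_onto_onto.
have onto' y : y != 0 -> forall z, exists2 S, sot_closure A S & S y = z.
  by move=> /onto[K _ HK] z; have [S [AS _ Sy]] := HK z; exists S.
have schur (D : X -> X) : linear D ->
    (forall S, sot_closure A S -> forall z, D (S z) = S (D z)) ->
    exists a, forall z, D z = a *: z.
  move=> lD cD; have [[x x0]|noX] := pselect (exists x : X, x != 0).
    have [K K0 HK] := onto x x0.
    exact: (commutant_scalar onto' x0 K0 HK lD cD).
  (* Here [X] is the zero space. *)
  exists 0 => z; rewrite scale0r; apply/eqP/negP => /negP Dz.
  by apply: noX; exists (D z).
(* Density for the closure gives exact agreement with [T] on [s]; returning to [A] costs only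
   [e]. *)
have [S cS ST] := jacobson_density (sot_closure_subalgebra sA) onto' schur T s.
have [S' AS' SS'] := cS s e e0.
by exists S' => // x xs; rewrite -(ST x xs); exact: SS'.
Qed.
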